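(* Let $M$ be a disconnected binary matroid and let $X$ be a non-empty independent set in $M$. Then the $\Gamma$-extension matroid $M^X$ is connected if and only if every connected component of $M$ intersects $X$.
   Context: Let $M$ be a binary matroid with ground set $S$, represented over $GF(2)$ by a (standard) matrix $A$ whose columns are labeled by $S$. Let $X=\{x_1,\dots,x_m\}\subset S$ be a non-empty independent set of $M$ and let $\Gamma=\{\gamma_1,\dots,\gamma_m\}$ be a set disjoint from $S$. Let $A'$ be obtained from $A$ by adjoining $m$ new columns labeled $\gamma_1,\dots,\gamma_m$, where the column labeled $\gamma_i$ equals the column labeled $x_i$. Let $A^X$ be obtained from $A'$ by adjoining one extra row having entry $1$ in each column labeled $\gamma_i$ ($i=1,\dots,m$) and $0$ elsewhere. The $\Gamma$-extension $M^X$ of $M$ is the vector matroid of $A^X$ over $GF(2)$; its ground set is $S\cup\Gamma$. A matroid is connected if it has no $1$-separation, i.e. no partition of its ground set into two non-empty sets $A,B$ with $r(A)+r(B)=r(M)$; the components of $M$ are its maximal connected restrictions (the classes of the relation ''lie in a common circuit or are equal''). Throughout the paper all matroids are assumed loopless and coloopless. *)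

(* Defs.v *)
From HB Require Import structures.
From mathcomp Require Import all_boot all_order all_algebra.

Set Implicit Arguments.
Unset Strict Implicit.
Unset Printing Implicit Defensive.

Import GRing.Theory.

(* The ground set is the whole finite type E. *)
Record matroid (E : finType) := Matroid {
  indep : {set {set E}};
  indep_set0 : set0 \in indep;
  indep_sub : forall I J : {set E}, I \subset J -> J \in indep -> I \in indep;
  indep_exchange : forall I J : {set E}, I \in indep -> J \in indep ->
    #|I| < #|J| -> exists2 e, e \in J :\: I & e |: I \in indep }.

Section MatroidNotions.
Variables (E : finType) (M : matroid E).

Definition rank (B : {set E}) : nat :=
  \max_(I in indep M | I \subset B) #|I|.

Definition basis (B : {set E}) : bool := maxset (mem (indep M)) B.

Definition loop (e : E) : bool := [set e] \notin indep M.

Definition coloop (e : E) : bool := [forall (B | basis B), e \in B].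

Definition loopless : bool := [forall e, ~~ loop e].

Definition coloopless : bool := [forall e, ~~ coloop e].

Definition one_separation (A B : {set E}) : bool :=
  [&& A :|: B == setT, [disjoint A & B], A != set0, B != set0
    & rank A + rank B == rank setT].

Definition connected : bool :=
  ~~ [exists A : {set E}, exists B : {set E}, one_separation A B].

End MatroidNotions.

Section Restriction.
Variables (E : finType) (M : matroid E) (B : {set E}).

Definition restr_indep : {set {set {e : E | e \in B}}} :=
  [set I : {set {e : E | e \in B}} | [set val e | e in I] \in indep M].

Lemma restr_set0 : set0 \in restr_indep.
Proof. by rewrite inE imset0 indep_set0. Qed.

Lemma restr_sub (I J : {set {e : E | e \in B}}) :
  I \subset J -> J \in restr_indep -> I \in restr_indep.
Proof. by rewrite !inE => sIJ; apply: indep_sub; apply: imsetS. Qed.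

Lemma restr_exchange (I J : {set {e : E | e \in B}}) :
  I \in restr_indep -> J \in restr_indep -> #|I| < #|J| ->
  exists2 e, e \in J :\: I & e |: I \in restr_indep.
Proof.
rewrite !inE => iI iJ ltIJ.
have [|_ /setDP[/imsetP[e eJ ->] eI] ieI] := indep_exchange iI iJ.
  by rewrite !card_imset //; apply: val_inj.
exists e; last by rewrite inE imsetU1.
by rewrite inE eJ andbT; apply: contra eI; apply: imset_f.
Qed.

Definition restrict : matroid {e : E | e \in B} :=
  Matroid restr_set0 restr_sub restr_exchange.

End Restriction.

Definition component (E : finType) (M : matroid E) (B : {set E}) : bool :=
  maxset (fun C : {set E} => connected (restrict M C)) B.

(* A matrix with r rows whose columns are labeled by E, given as the family   *)
(* of its columns.                                                            *)
Definition labeled_mx (F : fieldType) (r : nat) (E : finType) : Type :=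
  E -> 'cV[F]_r.

Section VectorMatroid.
Variables (F : fieldType) (r : nat) (E : finType) (A : labeled_mx F r E).

(* The columns form a family: equal columns with distinct labels are          *)
(* dependent, since a free sequence has no repetition.                        *)
Definition free_cols (I : {set E}) : bool := free [seq A e | e <- enum I].

Definition vec_indep : {set {set E}} := [set I | free_cols I].

Lemma free_colsU1 (e : E) (I : {set E}) : e \notin I ->
  free_cols (e |: I) =
    (A e \notin <<[seq A i | i <- enum I]>>%VS) && free_cols I.
Proof.
move=> eI; rewrite /free_cols -free_cons -map_cons; apply/perm_free/perm_map.
apply: uniq_perm; rewrite ?enum_uniq //= ?mem_enum ?eI ?enum_uniq //.
by move=> i; rewrite !inE !mem_enum !inE.
Qed.

Lemma vec_set0 : set0 \in vec_indep.
Proof. by rewrite inE /free_cols enum_set0 nil_free. Qed.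

Lemma vec_sub (I J : {set E}) :
  I \subset J -> J \in vec_indep -> I \in vec_indep.
Proof.
rewrite !inE /free_cols => sIJ fJ.
have : perm_eq (enum J) (enum I ++ enum (J :\: I)).
  apply: uniq_perm; rewrite ?enum_uniq // ?cat_uniq ?enum_uniq ?andbT /=.
    by apply/hasPn=> i; rewrite !mem_enum inE => /andP[].
  move=> i; rewrite mem_cat !mem_enum inE.
  by case: (boolP (i \in I)) => //= /(subsetP sIJ).
move=> /(perm_map A)/perm_free; rewrite fJ map_cat => /esym.
exact: catl_free.
Qed.

Lemma vec_exchange (I J : {set E}) :
  I \in vec_indep -> J \in vec_indep -> #|I| < #|J| ->
  exists2 e, e \in J :\: I & e |: I \in vec_indep.
Proof.
rewrite !inE => fI fJ ltIJ.
case: (pickP [pred e in J | A e \notin <<[seq A i | i <- enum I]>>%VS]).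
  move=> e /= /andP[eJ eI].
  have eNI : e \notin I.
    by apply: contra eI => eI; rewrite memv_span // map_f // mem_enum.
  by exists e; rewrite !inE ?eNI // free_colsU1 // eI.
move=> spanJ; have : (<<[seq A i | i <- enum J]>> <=
                      <<[seq A i | i <- enum I]>>)%VS.
  apply/span_subvP=> _ /mapP[j + ->]; rewrite mem_enum => jJ.
  by have := spanJ j; rewrite /= jJ /= => /negbFE.
move=> /dimvS; move: fI fJ; rewrite /free_cols /free => /eqP-> /eqP->.
by rewrite !size_map -!cardE leqNgt ltIJ.
Qed.

Definition vector_matroid : matroid E :=
  Matroid vec_set0 vec_sub vec_exchange.

End VectorMatroid.

Definition represents (F : fieldType) (r : nat) (E : finType)
    (A : labeled_mx F r E) (M : matroid E) : Prop :=
  indep M = indep (vector_matroid A).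

Section GammaExtension.
Variables (r m : nat) (E : finType).
Variables (A : labeled_mx 'F_2 r E) (x : 'I_m -> E).

(* The new label gamma_i is [inr i], so that the extended ground set is the   *)
(* disjoint union E + 'I_m.                                                   *)
Definition adjoin_cols : labeled_mx 'F_2 r (E + 'I_m)%type :=
  fun e => match e with inl s => A s | inr i => A (x i) end.

Definition gamma_row (e : E + 'I_m) : 'F_2 :=
  match e with inl _ => 0%R | inr _ => 1%R end.

Definition gamma_mx : labeled_mx 'F_2 (r + 1) (E + 'I_m)%type :=
  fun e => col_mx (adjoin_cols e) (const_mx (gamma_row e)).

Definition gamma_ext : matroid (E + 'I_m)%type := vector_matroid gamma_mx.

End GammaExtension.

(* Main.v *)
Require Import Defs.
From mathcomp Require Import all_boot all_order all_algebra.

(** For a represented matroid, [(D, ~: D)] is a separation exactly when the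
    spans of the columns in [D] and outside [D] meet trivially, and each
    component lies on one side of every separation and is itself a separator.
    A component avoiding [X] still spans a subspace that meets the span of the
    other columns trivially after the extension.  Conversely, a separation of
    the extension with elements of [S] on both sides restricts to one of [M],
    so when every component meets [X] there are [x i] and [x j] on opposite
    sides; since [gamma i - x i = gamma j - x j] is the new basis vector, each
    placement of [gamma i] and [gamma j] yields a nonzero vector in both
    spans. *)

Import GRing.Theory.
Local Open Scope ring_scope.

Set Implicit Arguments.
Unset Strict Implicit.
Unset Printing Implicit Defensive.

(** * Column spans and separations of a represented matroid *)

Definition cspan (F : fieldType) (r : nat) (E : finType)
    (A : labeled_mx F r E) (B : {set E}) : {vspace 'cV[F]_r} :=
  (\sum_(e in B) <[A e]>)%VS.

Section ColumnSpan.
Variables (F : fieldType) (r : nat) (E : finType) (A : labeled_mx F r E).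
Implicit Types (B C D P Q : {set E}) (e : E).

Lemma cspanE B : cspan A B = <<[seq A e | e <- enum B]>>%VS.
Proof. by rewrite span_def big_map big_enum. Qed.

Lemma mem_cspan e B : e \in B -> A e \in cspan A B.
Proof. by move=> eB; rewrite memvE (sumv_sup e). Qed.

Lemma cspan_subvP B (V : {vspace 'cV[F]_r}) :
  reflect (forall e, e \in B -> A e \in V) (cspan A B <= V)%VS.
Proof. by apply: (iffP subv_sumP) => H e /H; rewrite memvE. Qed.

Lemma cspanS B C : B \subset C -> (cspan A B <= cspan A C)%VS.
Proof.
by move=> /subsetP sBC; apply/cspan_subvP => e /sBC; apply: mem_cspan.
Qed.

Lemma cspanU B C : cspan A (B :|: C) = (cspan A B + cspan A C)%VS.
Proof.
apply/eqP; rewrite eqEsubv subv_add !cspanS ?subsetUl ?subsetUr // !andbT.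
apply/cspan_subvP => e /setUP[] /mem_cspan.
  exact/subvP/addvSl.
exact/subvP/addvSr.
Qed.

(** Used below for the two blocks of an extended column and for the embedding that appends a zero
    row. *)
Lemma cspan_linear s (f : {linear 'cV[F]_r -> 'cV[F]_s}) B
    (V : {vspace 'cV[F]_s}) v :
  (forall e, e \in B -> f (A e) \in V) -> v \in cspan A B -> f v \in V.
Proof.
move=> fV; have /subvP sub : (cspan A B <= linfun f @^-1: V)%VS.
  by apply/cspan_subvP => e /fV; rewrite -memv_preim lfunE.
by move=> /sub; rewrite -memv_preim lfunE.
Qed.

Variables (M : matroid E) (hA : represents A M).

Lemma indepE B : (B \in indep M) = free_cols A B.
Proof. by rewrite hA inE. Qed.

Lemma indep_dim B : B \in indep M -> \dim (cspan A B) = #|B|.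
Proof.
by rewrite indepE cspanE /free_cols /free size_map -cardE => /eqP.
Qed.

Lemma rankE B : rank M B = \dim (cspan A B).
Proof.
apply/eqP; rewrite eqn_leq; apply/andP; split.
  by apply/bigmax_leqP => I /andP[/indep_dim <- sIB]; apply/dimvS/cspanS.
(* A maximal independent subset of [B] spans every column of [B], since a column outside its span
   could be added to it. *)
have [|I] := @maxset_exists _ (fun I => (I \in indep M) && (I \subset B)) set0.
  by rewrite indep_set0 sub0set.
move=> /maxsetP[/andP[iI sIB] maxI] _.
apply: (@leq_trans #|I|); last first.
  by apply: (@leq_bigmax_cond _ _ (fun J : {set E} => #|J|)); apply/andP.
rewrite -(indep_dim iI); apply/dimvS/cspan_subvP => e eB; apply/negPn/negP => eI.
have eNI : e \notin I by apply: contra eI; apply: mem_cspan.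
case/negP: (eNI); suff <- : e |: I = I by apply: setU11.
apply: maxI; last exact: subsetUr.
by rewrite indepE free_colsU1 // -indepE iI -cspanE eI subUset sub1set eB.
Qed.

(** By the dimension formula for a sum of two subspaces, the defect in additivity of the rank is the
    dimension of the intersection. *)
Lemma rank_addE P Q :
  (rank M P + rank M Q == rank M (P :|: Q))%N =
    (cspan A P :&: cspan A Q == 0)%VS.
Proof.
rewrite !rankE cspanU -dimv_sum_cap -dimv_eq0.
by rewrite -[X in _ == X]addn0 eqn_add2l.
Qed.

Lemma connectedP :
  reflect (forall D, D != set0 -> (cspan A D :&: cspan A (~: D) = 0)%VS ->
             D = setT)
          (connected M).
Proof.
apply: (iffP idP) => [/existsPn cM D D0 capD | cM].
  apply/eqP/negPn/negP => DT; case/negP: (cM D); apply/existsP; exists (~: D).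
  rewrite /one_separation setUCr eqxx -setI_eq0 setICr eqxx D0 -(setUCr D).
  by rewrite rank_addE capD eqxx andbT -setCT (inj_eq (@setC_inj E)).
apply/existsP => -[P /existsP[Q /and5P[/eqP PQT dPQ P0 Q0]]].
rewrite -PQT rank_addE.
have -> : Q = ~: P.
  apply/setP => e; have := in_setT e; rewrite -PQT !inE.
  by have := disjointFr dPQ (x := e); case: (e \in P) => //= ->.
move=> /eqP/(cM P P0) PT; move: dPQ Q0.
by rewrite PT -setI_eq0 setTI => ->.
Qed.

End ColumnSpan.

(** * Connected restrictions and components in terms of spans *)

Section Components.
Variables (F : fieldType) (r : nat) (E : finType) (A : labeled_mx F r E).
Variables (M : matroid E) (hA : represents A M).
Implicit Types (B C D P Q : {set E}) (e : E).

Lemma cspan_comp_inj (E' : finType) (f : E' -> E) (D : {set E'}) :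
  injective f -> cspan (A \o f) D = cspan A (f @: D).
Proof. by move=> fI; rewrite /cspan big_imset //= => ? ? _ _ /fI. Qed.

Lemma restrict_represents C :
  represents (A \o val : labeled_mx F r {e | e \in C}) (restrict M C).
Proof.
apply/setP => I; rewrite /= !inE hA inE /free_cols (map_comp A val).
apply/perm_free/perm_map/uniq_perm; rewrite ?enum_uniq //.
  by rewrite map_inj_uniq ?enum_uniq //; apply: val_inj.
move=> e; rewrite mem_enum; apply/imsetP/mapP => -[i iI ->]; exists i => //.
  by rewrite mem_enum.
by rewrite mem_enum in iI.
Qed.

(** This moves connectivity from the subtype of [C] back to [E]; [D] may be any subset of [E], only
    its trace on [C] matters. *)
Lemma connected_restrictP C :
  connected (restrict M C) <->
  (forall D, C :&: D != set0 ->
     (cspan A (C :&: D) :&: cspan A (C :\: D) = 0)%VS -> C \subset D).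
Proof.
have cspan_val (D : {set {e | e \in C}}) :
  cspan (A \o val) D = cspan A (val @: D) by apply/cspan_comp_inj/val_inj.
have valI D : val @: [set e : {e | e \in C} | val e \in D] = C :&: D.
  apply/setP => e; apply/imsetP/setIP => [[i + ->]|[eC eD]].
    by rewrite inE => iD; split => //; apply: (valP i).
  by exists (exist _ e eC); rewrite ?inE.
split=> [/(connectedP (@restrict_represents C)) cC D CD0 capD | cC].
  have := cC [set e | val e \in D]; rewrite !cspan_val valI.
  have -> : ~: [set e : {e | e \in C} | val e \in D] =
            [set e | val e \in ~: D] by apply/setP => e; rewrite !inE.
  rewrite valI -setDE => /(_ _ capD) DT.
  apply/subsetP => e eC; have := in_setT (exist _ e eC : {e | e \in C}).
  rewrite -DT ?inE //; case/set0Pn: CD0 => i /setIP[iC iD].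
  by apply/set0Pn; exists (exist _ i iC); rewrite inE.
apply/(connectedP (@restrict_represents C)) => D /set0Pn[d dD].
rewrite !cspan_val.
have valD (e : {e | e \in C}) : (val e \in val @: D) = (e \in D).
  by rewrite mem_imset //; apply: val_inj.
have DE : val @: D = C :&: val @: D.
  rewrite -valI; suff {1}-> : D = [set e | val e \in val @: D] by [].
  by apply/setP => e; rewrite inE valD.
have DCE : val @: (~: D) = C :\: val @: D.
  rewrite setDE -valI.
  suff {1}-> : ~: D = [set e | val e \in ~: (val @: D)] by [].
  by apply/setP => e; rewrite !inE valD.
move=> capD; have := cC (val @: D); rewrite -DE -DCE => /(_ _ capD) sCD.
apply/setP => e; rewrite inE -valD (subsetP (sCD _)) ?(valP e) //.
by apply/set0Pn; exists (val d); rewrite valD.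
Qed.

Lemma connected_side C D e :
    connected (restrict M C) -> (cspan A D :&: cspan A (~: D) = 0)%VS ->
  e \in C -> e \in D -> C \subset D.
Proof.
move=> /connected_restrictP cC capD eC eD; apply: cC.
  by apply/set0Pn; exists e; rewrite inE eC.
apply/eqP; rewrite -subv0 -capD capvS // cspanS ?subsetIr //.
by rewrite setDE subsetIr.
Qed.

Lemma connected1 e : connected (restrict M [set e]).
Proof.
apply/connected_restrictP => D /set0Pn[i /setIP[/set1P->]] eD _.
by rewrite sub1set.
Qed.

Lemma mem_component e : exists2 B, component M B & e \in B.
Proof.
have [B mB eB] := @maxset_exists _
  (fun C => connected (restrict M C)) _ (connected1 e).
by exists B => //; rewrite -sub1set.
Qed.

Lemma component_connected B : component M B -> connected (restrict M B).
Proof. by move=> /maxsetP[]. Qed.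

(** The element [e] excludes an empty ground set, where [set0] itself is a component. *)
Lemma component_neq0 B e : component M B -> B != set0.
Proof.
move=> /maxsetP[_ maxB]; apply/eqP => B0; subst B.
have /setP/(_ e) := maxB _ (connected1 e) (sub0set _).
by rewrite !inE eqxx.
Qed.

(* A minimal separator [D] containing [B] is connected: if [P :|: Q = D] were a
   separation with [B] inside [P], then [P] would be a smaller separator. *)
Lemma component_separator B e :
  component M B -> e \in B -> (cspan A B :&: cspan A (~: B) = 0)%VS.
Proof.
move=> cB eB; have conB := component_connected cB.
pose sep D := (B \subset D) && (cspan A D :&: cspan A (~: D) == 0)%VS.
have sepT : sep setT.
  by rewrite /sep subsetT setCT /cspan big_set0 capv0 eqxx.
have [D /minsetP[/andP[sBD /eqP capD] minD] _] := minset_exists sepT.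
suff cD : connected (restrict M D).
  by case/maxsetP: cB => _ /(_ D cD sBD) <-.
(* A separation of the restriction to the separator [D] yields a separator of [M]: if [v = q + c]
   with [c] in the span of [~: D], then [c = v - q] also lies in the span of [D], so [c = 0]. *)
have sepI P : (cspan A (D :&: P) :&: cspan A (D :\: P) = 0)%VS ->
    (cspan A (D :&: P) :&: cspan A (~: (D :&: P)) = 0)%VS.
  move=> capP; apply/eqP; rewrite -subv0; apply/subvP => v /memv_capP[vP].
  have -> : ~: (D :&: P) = (D :\: P) :|: ~: D.
    by apply/setP => i; rewrite !inE; case: (i \in D); case: (i \in P).
  rewrite cspanU => /memv_addP[q qQ [c cC vqc]].
  have c0 : c = 0.
    apply/eqP; rewrite -memv0 -capD memv_cap cC andbT.
    have -> : c = v - q by rewrite vqc addrC addKr.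
    apply: rpredB; first exact: (subvP (cspanS A (subsetIl D P))).
    exact: (subvP (cspanS A (subsetDl D P))).
  by rewrite -capP memv_cap vP vqc c0 addr0 qQ.
(* The side containing [e] contains all of the connected set [B], so minimality of [D] applies to
   it. *)
have minI P : e \in P -> (cspan A (D :&: P) :&: cspan A (D :\: P) = 0)%VS ->
    D \subset P.
  move=> eP /sepI capP; apply/setIidPl/minD; last exact: subsetIl.
  rewrite /sep capP eqxx andbT; apply: (connected_side conB capP eB).
  by rewrite inE eP (subsetP sBD).
apply/connected_restrictP => P DP0 capP.
have [eP|eP] := boolP (e \in P); first exact: minI.
have /subsetP sDCP : D \subset ~: P.
  by apply: minI; rewrite ?inE // -setDE capvC setDE setCK.
by case/set0Pn: DP0 => i /setIP[/sDCP]; rewrite inE => /negPf->.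
Qed.

Lemma separator_meets (X : {set E}) D :
    (forall B, component M B -> B :&: X != set0) ->
    (cspan A D :&: cspan A (~: D) = 0)%VS -> D != set0 ->
  exists2 i, i \in D & i \in X.
Proof.
move=> XB capD /set0Pn[e eD]; have [B cB eB] := mem_component e.
have /set0Pn[i /setIP[iB iX]] := XB B cB; exists i => //.
exact: (subsetP (connected_side (component_connected cB) capD eB eD)).
Qed.

End Components.

(** * Separations of the extension compared with those of the original matrix *)

Section GammaSpans.
Variables (r m : nat) (S : finType) (A : labeled_mx 'F_2 r S) (x : 'I_m -> S).
Implicit Types (D : {set S}) (P : {set S + 'I_m}).

Let g := gamma_mx A x.

(** A common vector has zero bottom entry because the columns from [D] do. Its top block lies in
    both spans over [A], as the top of each gamma column is some [A (x i)] with [x i] outside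
    [D]. *)
Lemma gamma_inl_cap0 D : (forall i, x i \notin D) ->
    (cspan A D :&: cspan A (~: D) = 0)%VS ->
  (cspan g (inl @: D) :&: cspan g (~: (inl @: D)) = 0)%VS.
Proof.
move=> xD capD; apply/eqP; rewrite -subv0; apply/subvP => v /memv_capP[vD vC].
have uD : usubmx v \in cspan A D.
  apply: cspan_linear vD => _ /imsetP[s sD ->].
  by rewrite /= /g /gamma_mx col_mxKu /= mem_cspan.
have uC : usubmx v \in cspan A (~: D).
  apply: cspan_linear vC => -[s|i]; rewrite inE /= /g /gamma_mx col_mxKu /= => sD.
    by rewrite mem_cspan // inE; apply: contra sD; apply: imset_f.
  by rewrite mem_cspan // inE xD.
have d0 : dsubmx v = 0.
  apply/eqP; rewrite -memv0; apply: cspan_linear vD => _ /imsetP[s _ ->].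
  by rewrite /= /g /gamma_mx col_mxKd mem0v.
have u0 : usubmx v = 0.
  by apply/eqP; rewrite -memv0 -capD memv_cap uD.
by rewrite -(vsubmxK v) u0 d0 col_mx0 mem0v.
Qed.

(** Appending a zero is an injective linear map carrying each column of [A] to its copy in the
    extension. *)
Lemma gamma_preim_cap0 P : (cspan g P :&: cspan g (~: P) = 0)%VS ->
  (cspan A (inl @^-1: P) :&: cspan A (~: (inl @^-1: P)) = 0)%VS.
Proof.
move=> capP; pose C := col_mx 1%:M 0 : 'M['F_2]_(r + 1, r).
have CE (v : 'cV_r) : C *m v = col_mx v 0.
  by rewrite mul_col_mx mul1mx mul0mx.
have CA (Q : {set S + 'I_m}) v : v \in cspan A (inl @^-1: Q) -> C *m v \in cspan g Q.
  apply: (cspan_linear (f := mulmx C)) => s; rewrite inE => /(mem_cspan g).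
  by rewrite /= CE.
apply/eqP; rewrite -subv0; apply/subvP => v.
rewrite -preimsetC => /memv_capP[/CA vP /CA vC].
have : C *m v \in 0%VS by rewrite -capP memv_cap vP.
by rewrite !memv0 CE col_mx_eq0 => /andP[].
Qed.

Lemma gamma_inr i j : g (inr i) - g (inl (x i)) = g (inr j) - g (inl (x j)).
Proof. by rewrite /g /gamma_mx /= !opp_col_mx !add_col_mx !subrr. Qed.

Lemma gamma_usub s : usubmx (g (inl s)) = A s.
Proof. by rewrite /g /gamma_mx col_mxKu. Qed.

Lemma gamma_dsub s : dsubmx (g (inl s)) = 0.
Proof. by rewrite /g /gamma_mx col_mxKd. Qed.

Lemma gamma_inr_neq0 i u : dsubmx u = 0 -> g (inr i) + u != 0.
Proof.
move=> u0; apply/eqP => /(congr1 dsubmx).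
rewrite linearD linear0 /= u0 addr0 /g /gamma_mx col_mxKd.
by move=> /matrixP/(_ 0 0)/eqP; rewrite !mxE oner_eq0.
Qed.

End GammaSpans.

Theorem theorem2p7 (S : finType) (M : matroid S)
    (r : nat) (A : labeled_mx 'F_2 r S) (hA : represents A M)
    (hloop : loopless M) (hcoloop : coloopless M)
    (hM : ~~ connected M)
    (X : {set S}) (hX0 : X != set0) (hX : X \in indep M)
    (m : nat) (x : 'I_m -> S) (x_inj : injective x)
    (hx : X = [set x i | i : 'I_m]) :
  connected (gamma_ext A x) <->
  (forall B : {set S}, component M B -> B :&: X != set0).
Proof.
have hg : represents (gamma_mx A x) (gamma_ext A x) by [].
have xX i : x i \in X by rewrite hx imset_f.
split=> [/(connectedP hg) cg B cB | XB].
  (* A component avoiding [X] would be a separator of the extension, hence the whole ground set, yet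
     it contains no gamma label. *)
  case/set0Pn: (hX0) => s0 s0X; apply/negP => /eqP BX0.
  have /set0Pn[b bB] := component_neq0 hA s0 cB.
  have xB i : x i \notin B.
    by apply/negP => iB; have /setP/(_ (x i)) := BX0; rewrite !inE iB xX.
  have := cg _ _ (gamma_inl_cap0 xB (component_separator hA cB bB)).
  have -> : inl @: B != set0 :> {set S + 'I_m}.
    by apply/set0Pn; exists (inl b); apply: imset_f.
  move: s0X; rewrite hx => /imsetP[i _ _] /(_ isT)/setP/(_ (inr i)).
  by rewrite inE => /imsetP[].
have meets D : (cspan A D :&: cspan A (~: D) = 0)%VS -> D != set0 ->
    exists i, x i \in D.
  move=> capD D0; have [s sD] := separator_meets hA XB capD D0.
  by rewrite hx => /imsetP[i _ si]; exists i; rewrite -si.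
(* Both sides of a separation of the disconnected [M] meet [X], so there are at least two gamma
   labels. *)
have other (k : 'I_m) : exists l, l != k.
  have [l lk|onlyk] := pickP (predC1 k); first by exists l.
  case/negP: hM.
  apply/(connectedP hA) => D D0 capD; apply/eqP/negPn/negP => DT.
  have [i iD] := meets D capD D0.
  have [||j] := meets (~: D); first by rewrite setCK capvC.
    by rewrite -setCT (inj_eq (@setC_inj S)).
  have /negbFE/eqP-> := onlyk j; have /negbFE/eqP ik := onlyk i.
  by rewrite inE -ik iD.
have freeX : free_cols A X by rewrite -(indepE hA).
have Ainj i j : A (x i) = A (x j) -> i = j.
  have /dinjectiveP injA : dinjectiveb A X by apply: free_uniq freeX.
  by move/injA => /(_ (xX i) (xX j))/x_inj.
set g := gamma_mx A x.
have gl0 i : g (inl (x i)) != 0.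
  apply/eqP => /(congr1 usubmx); rewrite gamma_usub linear0; apply/eqP.
  by apply: free_not0 freeX _; rewrite map_f // mem_enum.
have gE i j : g (inr i) - g (inl (x i)) = g (inr j) - g (inl (x j)).
  exact: gamma_inr.
have capE P v : (cspan g P :&: cspan g (~: P) = 0)%VS ->
    v \in cspan g P -> v \in cspan g (~: P) -> v = 0.
  by move=> capP vP vC; apply/eqP; rewrite -memv0 -capP memv_cap vP.
have side P e : (g e \in cspan g P) \/ (g e \in cspan g (~: P)).
  have [eP|eP] := boolP (e \in P); [left | right]; apply: mem_cspan => //.
  by rewrite inE.
(* No side consists of gamma labels only. With gamma [k] in [P] and all of [S] outside, take another
   label [l]. If gamma [l] is in [P], the difference of the two gamma columns equals that of the
   columns of [x k] and [x l], so it is in both spans and [A (x k) = A (x l)]. Otherwise gamma [k]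
   itself is spanned by the complement. *)
have meets_inl P : (cspan g P :&: cspan g (~: P) = 0)%VS -> P != set0 ->
    inl @^-1: P != set0.
  move=> capP /set0Pn[[s|k] eP]; first by apply/set0Pn; exists s; rewrite inE.
  apply/negP => /eqP P0; have [l /eqP lk] := other k.
  have inC s : g (inl s) \in cspan g (~: P).
    by apply: mem_cspan; have /setP/(_ s) := P0; rewrite !inE => ->.
  have kP := mem_cspan g eP; case: (side P (inr l)) => lP.
    apply/lk/Ainj/esym; rewrite -!(gamma_usub A x); congr usubmx.
    apply/eqP; rewrite -subr_eq0; apply/eqP/(capE P) => //; last exact: rpredB.
    have -> : g (inl (x k)) - g (inl (x l)) = g (inr k) - g (inr l).
      rewrite -[g (inr k)](subrK (g (inl (x k)))) (gE k l) addrAC.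
      by rewrite [g (inr l) - _]addrC addrK addrC.
    exact: rpredB.
  have := @gamma_inr_neq0 _ _ _ A x k 0 (linear0 _).
  rewrite addr0 -/g => /negP; apply; apply/eqP/(capE P) => //.
  have -> : g (inr k) = g (inr l) - g (inl (x l)) + g (inl (x k)).
    by rewrite -(gE k l) subrK.
  by rewrite rpredD ?rpredB.
apply/(connectedP hg) => P P0 capP; apply/eqP/negPn/negP => PT.
have capC : (cspan g (~: P) :&: cspan g (~: ~: P) = 0)%VS.
  by rewrite setCK capvC.
have C0 : ~: P != set0 by rewrite -setCT (inj_eq (@setC_inj _)).
have [i] := meets _ (gamma_preim_cap0 capP) (meets_inl P capP P0).
have [j] := meets _ (gamma_preim_cap0 capC) (meets_inl _ capC C0).
rewrite ![_ \in _ @^-1: _]inE => /(mem_cspan g) jC /(mem_cspan g) iP.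
(* Here [x i] is in [P] and [x j] in its complement. The nonzero vector in both spans is, in order,
   the column of [x j], the new basis vector, gamma [i] plus the column of [x j], and the column of
   [x i]. *)
case: (side P (inr i)) (side P (inr j)) => [iP'|iC'] [jP'|jC'].
- case/negP: (gl0 j); apply/eqP/(capE P) => //.
  have -> : g (inl (x j)) = g (inr j) - (g (inr i) - g (inl (x i))).
    by rewrite (gE i j) opprB addrC subrK.
  by rewrite !rpredB.
- have /eqP[] : g (inr i) - g (inl (x i)) != 0.
    by apply: gamma_inr_neq0; rewrite linearN /= gamma_dsub oppr0.
  by apply/(capE P) => //; last rewrite (gE i j); apply: rpredB.
- have /eqP[] : g (inr i) + g (inl (x j)) != 0.
    by apply: gamma_inr_neq0; rewrite gamma_dsub.
  apply/(capE P) => //; last exact: rpredD.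
  have -> : g (inr i) + g (inl (x j)) = g (inr j) + g (inl (x i)).
    by rewrite -[g (inr i)](subrK (g (inl (x i)))) (gE i j) addrAC subrK.
  exact: rpredD.
- case/negP: (gl0 i); apply/eqP/(capE P) => //.
  have -> : g (inl (x i)) = g (inr i) - (g (inr j) - g (inl (x j))).
    by rewrite -(gE i j) opprB addrC subrK.
  by rewrite !rpredB.
Qed.
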